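(* Let $\tau$ be a countable relational vocabulary, $K\subseteq Mod(\tau)$ isomorphism invariant, and $\vec{\mathcal{A}}=(\mathcal{A}_i)_{i\in\omega}\in K^\omega$. The following are equivalent: (1) $\vec{\mathcal{A}}$ is $\mathbf{Ex}$-learnable; (2) $\vec{\mathcal{A}}$ is $\mathbf{BC}$-learnable; (3) for every $i$ there is a tuple $\bar a$ in $\mathcal{A}_i$ such that for every $j$ and every tuple $\bar b$ in $\mathcal{A}_j$, either $(\mathcal{A}_i,\bar a)\not\le_1(\mathcal{A}_j,\bar b)$ or $\mathcal{A}_i\cong\mathcal{A}_j$; (4) $\vec{\mathcal{A}}$ has $\Sigma^{\mathrm{in}}_2$ quasi-Scott sentences, i.e. there are $\Sigma^{\mathrm{in}}_2$ sentences $(\varphi_i)_{i\in\omega}$ such that for all $i,j$, $\mathcal{A}_i\models\varphi_j$ iff $\mathcal{A}_i\cong\mathcal{A}_j$. Furthermore, if the structures $\mathcal{A}_i$ are pairwise non-isomorphic, then (3) can be replaced by: (3a) for every $i$ there is a tuple $\bar a$ in $\mathcal{A}_i$ such that for every $j\neq i$ and every tuple $\bar b$ in $\mathcal{A}_j$, $(\mathcal{A}_i,\bar a)\not\le_1(\mathcal{A}_j,\bar b)$.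
   Context: $Mod(\tau)$ is the set of $\tau$-structures with universe $\omega$, identified with a subset of $\prod_{i}2^{\omega^{a_i}}$ ($a_i$ the arity of the $i$-th symbol) with the product topology. A learner is a continuous function $\mathbf{L}:K\to\omega^\omega$. $\vec{\mathcal{A}}$ is $\mathbf{Ex}$-learnable if there is a learner $\mathbf{L}$ such that for every $i$ and every $\mathcal{S}\in K$ with $\mathcal{S}\cong\mathcal{A}_i$, $\lim_n\mathbf{L}(\mathcal{S})(n)$ exists and $\mathcal{A}_{\lim_n\mathbf{L}(\mathcal{S})(n)}\cong\mathcal{A}_i$. $\vec{\mathcal{A}}$ is $\mathbf{BC}$-learnable if there is a learner $\mathbf{L}$ such that for every $i$ and every $\mathcal{S}\in K$ with $\mathcal{S}\cong\mathcal{A}_i$, $\mathcal{A}_{\mathbf{L}(\mathcal{S})(n)}\cong\mathcal{A}_i$ for all but finitely many $n$. The structures in $\vec{\mathcal{A}}$ need not be pairwise non-isomorphic. $\Sigma^{\mathrm{in}}_2$ sentences are sentences of $L_{\omega_1\omega}$ in the usual infinitary hierarchy (countable disjunctions of $\exists\bar x$ followed by $\Pi^{\mathrm{in}}_1$ formulas, the latter being countable conjunctions of $\forall\bar y$ followed by finitary quantifier-free formulas). Back-and-forth relation: fix an enumeration $(\phi_k)$ of atomic $\tau$-formulas; $(\mathcal{A},\bar a)\le_0(\mathcal{B},\bar b)$ iff for each $k<|\bar a|$, $\mathcal{A}\models\phi_k(\bar a)\iff\mathcal{B}\models\phi_k(\bar b)$; $(\mathcal{A},\bar a)\le_1(\mathcal{B},\bar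 b)$ iff for every tuple $\bar d$ in $\mathcal{B}$ there is a tuple $\bar c$ in $\mathcal{A}$ with $(\mathcal{B},\bar b\bar d)\le_0(\mathcal{A},\bar a\bar c)$. *)

(* Defs.v *)
From HB Require Import structures.
From mathcomp Require Import all_boot.
From mathcomp Require Import all_classical topology.

Set Implicit Arguments.
Unset Strict Implicit.
Unset Printing Implicit Defensive.

Local Open Scope classical_set_scope.

Record vocabulary := Vocabulary {
  symbol :> countType;
  arity : symbol -> nat }.

(* [nat] and [bool] carry the discrete topology; [prod_topology] is the
   topology of pointwise convergence. *)
Definition Mod (tau : vocabulary) :=
  prod_topology (fun R : tau =>
    prod_topology (fun _ : (arity R).-tuple nat => bool)).

Definition baire := prod_topology (fun _ : nat => nat).

Definition isomorphic (tau : vocabulary) (A B : Mod tau) : Prop :=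
  exists2 f : nat -> nat, bijective f &
    forall (R : tau) (t : (arity R).-tuple nat), A R t = B R (map_tuple f t).

Definition iso_invariant (tau : vocabulary) (K : set (Mod tau)) : Prop :=
  forall A B : Mod tau, isomorphic A B -> K A -> K B.

(* A learner is given as a total function; only its restriction to [K] is
   constrained. *)
Definition learner (tau : vocabulary) (K : set (Mod tau))
    (L : Mod tau -> baire) : Prop :=
  {within K, continuous L}.

Definition Ex_learnable (tau : vocabulary) (K : set (Mod tau))
    (A : nat -> Mod tau) : Prop :=
  exists2 L : Mod tau -> baire, learner K L &
    forall (i : nat) (S : Mod tau), K S -> isomorphic S (A i) ->
      exists2 l : nat, L S @ \oo --> l & isomorphic (A l) (A i).

Definition BC_learnable (tau : vocabulary) (K : set (Mod tau))
    (A : nat -> Mod tau) : Prop :=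
  exists2 L : Mod tau -> baire, learner K L &
    forall (i : nat) (S : Mod tau), K S -> isomorphic S (A i) ->
      \forall n \near \oo, isomorphic (A (L S n)) (A i).

Inductive atomic (tau : vocabulary) (V : Type) : Type :=
| AEq of V & V
| ARel (R : tau) of (arity R).-tuple V.

Definition atomic_sat (tau : vocabulary) (V : Type) (A : Mod tau)
    (v : V -> nat) (phi : atomic tau V) : bool :=
  match phi with
  | AEq x y => v x == v y
  | ARel R t => A R (map_tuple v t)
  end.

Definition atomic_vars (tau : vocabulary) (V : Type) (phi : atomic tau V) :
    seq V :=
  match phi with
  | AEq x y => [:: x; y]
  | ARel R t => t
  end.

(* phi(a) only makes sense when the variables of phi are among x_0, ...,
   x_(n-1), n being the length of a.  The guard on [atomic_vars] is void for
   enumerations in which phi_k uses no variable beyond x_k, and lets the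
   relation be defined for all enumerations; the default value of [nth] is
   never used. *)
Definition bf_le0 (tau : vocabulary) (phi : nat -> atomic tau nat)
    (A : Mod tau) (n : nat) (a : n.-tuple nat)
    (B : Mod tau) (b : n.-tuple nat) : Prop :=
  forall k : nat, k < n -> all (fun x => x < n) (atomic_vars (phi k)) ->
    atomic_sat A (nth 0 a) (phi k) <-> atomic_sat B (nth 0 b) (phi k).

Definition bf_le1 (tau : vocabulary) (phi : nat -> atomic tau nat)
    (A : Mod tau) (n : nat) (a : n.-tuple nat)
    (B : Mod tau) (b : n.-tuple nat) : Prop :=
  forall (m : nat) (d : m.-tuple nat), exists c : m.-tuple nat,
    bf_le0 phi B (cat_tuple b d) A (cat_tuple a c).

(* Finitary quantifier-free formulas in the variables x_0, ..., x_(n-1). *)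
Inductive qf (tau : vocabulary) (n : nat) : Type :=
| QFalse
| QAtom of atomic tau 'I_n
| QNot of qf tau n
| QAnd of qf tau n & qf tau n
| QOr of qf tau n & qf tau n.

Fixpoint qf_sat (tau : vocabulary) (n : nat) (A : Mod tau)
    (a : n.-tuple nat) (psi : qf tau n) : bool :=
  match psi with
  | QFalse => false
  | QAtom phi => atomic_sat A (tnth a) phi
  | QNot psi1 => ~~ qf_sat A a psi1
  | QAnd psi1 psi2 => qf_sat A a psi1 && qf_sat A a psi2
  | QOr psi1 psi2 => qf_sat A a psi1 || qf_sat A a psi2
  end.

(* /\_k forall y_0 ... y_(m_k - 1), psi_k(x_0, ..., x_(n-1), y), where k runs
   over a countable (possibly finite or empty) index set and m_k is
   [pi1_arity k]. *)
Record pi1 (tau : vocabulary) (n : nat) := Pi1 {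
  pi1_index : countType;
  pi1_arity : pi1_index -> nat;
  pi1_matrix : forall k : pi1_index, qf tau (n + pi1_arity k) }.

Definition pi1_sat (tau : vocabulary) (n : nat) (A : Mod tau)
    (a : n.-tuple nat) (psi : pi1 tau n) : Prop :=
  forall (k : pi1_index psi) (b : (pi1_arity k).-tuple nat),
    qf_sat A (cat_tuple a b) (pi1_matrix k).

(* \/_k exists x_0 ... x_(n_k - 1), psi_k(x), with no other free variable. *)
Record sigma2 (tau : vocabulary) := Sigma2 {
  sigma2_index : countType;
  sigma2_arity : sigma2_index -> nat;
  sigma2_matrix : forall k : sigma2_index, pi1 tau (sigma2_arity k) }.

Definition sigma2_sat (tau : vocabulary) (A : Mod tau) (psi : sigma2 tau) :
    Prop :=
  exists (k : sigma2_index psi) (a : (sigma2_arity k).-tuple nat),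
    pi1_sat A a (sigma2_matrix k).

Definition has_sigma2_quasi_Scott_sentences (tau : vocabulary)
    (A : nat -> Mod tau) : Prop :=
  exists psi : nat -> sigma2 tau,
    forall i j : nat, sigma2_sat (A i) (psi j) <-> isomorphic (A i) (A j).

Definition bf_separated (tau : vocabulary) (phi : nat -> atomic tau nat)
    (A : nat -> Mod tau) : Prop :=
  forall i : nat, exists (n : nat) (a : n.-tuple nat),
    forall (j : nat) (b : n.-tuple nat),
      ~ bf_le1 phi (A i) a (A j) b \/ isomorphic (A i) (A j).

Definition bf_strongly_separated (tau : vocabulary)
    (phi : nat -> atomic tau nat) (A : nat -> Mod tau) : Prop :=
  forall i : nat, exists (n : nat) (a : n.-tuple nat),
    forall (j : nat) (b : n.-tuple nat),
      j <> i -> ~ bf_le1 phi (A i) a (A j) b.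

(* Main.v *)
Require Import Defs.
From mathcomp Require Import all_boot.
From mathcomp Require Import all_classical topology.

(** The only substantial implication is BC => (3).  If (3) fails at [A i], then
   every tuple [a] of [A i] satisfies [(A i, a) <=_1 (A j, b)] for some [b] and
   some [A j] not isomorphic to [A i].  Feed the learner a copy of [A j] whose
   enumeration starts with [b]: from some stage on it must answer with an index
   of [A j].  By continuity such an answer, given late enough, depends on
   finitely many atomic facts, and [<=_1] realizes these facts in [A i] by some
   [a ++ c].  Iterating, while also putting every element of [A i] into the
   tuple, enumerates a copy of [A i] on which the learner is wrong infinitely
   often.

   For (3) => (4), the existential closure of the Pi_1 theory of [(A i, a)] is a
   quasi-Scott sentence of [A i].  For (4) => Ex, guess the least pair
   (disjunct, witness), over all the sentences, that is not refuted so far. *)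

Set Implicit Arguments.
Unset Strict Implicit.
Unset Printing Implicit Defensive.

Local Open Scope classical_set_scope.

(** * Pointwise convergence and finite bounds *)

(** The product topology is the supremum of the topologies induced by the projections, so it is
    enough to test preimages of open sets under one projection. *)
Lemma cvg_prod_topology (I : Type) (T : I -> topologicalType)
    (F : set_system (prod_topology T)) {FF : Filter F} (f : prod_topology T) :
  F --> f <-> forall i, g i @[g --> F] --> f i.
Proof.
split=> [Ff i U fiU | Ff].
  have /cvg_sup/(_ i) Ffi := Ff; apply: Ffi.
  exact: (@initial_continuous _ _ (fun g : forall i, T i => g i) f U fiU).
apply/cvg_sup => i U /= [_ [[B Bop <-] Bfi sBU]].
rewrite nbhs_filterE; apply: filterS sBU _.
by apply: (Ff i); apply: open_nbhs_nbhs.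
Qed.

Lemma near_all_ltn (T : Type) (F : set_system T) (P : nat -> T -> Prop) N :
  Filter F -> (forall e, \forall x \near F, P e x) ->
  \forall x \near F, forall e, e < N -> P e x.
Proof.
move=> FF FP; elim: N => [|N IHN]; first by apply: nearW.
apply: filterS2 IHN (FP N) => x PltN PN e.
by rewrite ltnS leq_eqVlt => /predU1P[->|/PltN].
Qed.

Lemma exists_bound (P : nat -> nat -> Prop) N :
  (forall k m m', m <= m' -> P k m -> P k m') ->
  (forall k, k < N -> exists m, P k m) ->
  exists m, forall k, k < N -> P k m.
Proof.
move=> Pmono; elim: N => [|N IHN] exP; first by exists 0.
have [|m Pm] := IHN; first by move=> k /ltnW; exact: exP.
have [m' Pm'] := exP N (ltnSn N).
exists (maxn m m') => k; rewrite ltnS leq_eqVlt => /predU1P[->|/Pm Pk].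
  exact: Pmono (leq_maxr _ _) Pm'.
exact: Pmono (leq_maxl _ _) Pk.
Qed.

Lemma find_iota (p : pred nat) (e N : nat) :
  e < N -> p e -> (forall e', e' < e -> ~~ p e') -> find p (iota 0 N) = e.
Proof.
move=> ltN pe minp.
have hp : has p (iota 0 N) by apply/hasP; exists e; rewrite // mem_iota.
have ltf : find p (iota 0 N) < N by rewrite -{2}(size_iota 0 N) -has_find.
case: (ltngtP (find p (iota 0 N)) e) => //.
  by move/minp; have := nth_find 0 hp; rewrite nth_iota // add0n => ->.
by move/(before_find 0); rewrite nth_iota // add0n pe.
Qed.

(** * Permutations of the natural numbers from finite approximations *)

(** Since [a s] contains every number below [s], its length is at least [s]; hence
    [nth 0 (a x.+1) x] never falls back on the default. Injectivity comes from [uniq], surjectivity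
    from [y] occurring in [a y.+1]. *)
Lemma chain_limit (a : nat -> seq nat) :
  (forall s, uniq (a s)) -> (forall s, prefix (a s) (a s.+1)) ->
  (forall s, s \in a s.+1) ->
  exists2 g : nat -> nat, bijective g &
    forall s x, x < size (a s) -> g x = nth 0 (a s) x.
Proof.
move=> ua pa sa.
have pa_le s t : s <= t -> prefix (a s) (a t).
  move=> /subnK <-; elim: (t - s) => [|k IHk]; first exact: prefix_refl.
  exact: prefix_trans IHk (pa _).
have nth_le s t x : s <= t -> x < size (a s) -> nth 0 (a t) x = nth 0 (a s) x.
  by move=> /pa_le/prefixP[c ->] ltx; rewrite nth_cat ltx.
have size_a s : s <= size (a s).
  rewrite -{1}(size_iota 0 s); apply: uniq_leq_size (iota_uniq _ _) _ => x.
  rewrite mem_iota add0n /= => /pa_le/prefixP[c ->].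
  by rewrite mem_cat sa.
pose g x := nth 0 (a x.+1) x.
have gE s x : x < size (a s) -> g x = nth 0 (a s) x.
  move=> ltx; case: (leqP s x.+1) => [le|/ltnW le].
    by rewrite /g (nth_le _ _ _ le).
  by rewrite /g (nth_le _ _ _ le) //; exact: size_a.
have gK : cancel (fun y => index y (a y.+1)) g.
  by move=> y; rewrite (gE y.+1) ?nth_index // index_mem.
have g_inj : injective g.
  move=> x y; have lt z : z < (maxn x y).+1 -> z < size (a (maxn x y).+1).
    by move/leq_trans; apply.
  rewrite !(gE (maxn x y).+1) ?lt ?ltnS ?leq_maxl ?leq_maxr // => /eqP.
  by rewrite nth_uniq ?lt ?ltnS ?leq_maxl ?leq_maxr // => /eqP.
exists g => //; exists (fun y => index y (a y.+1)) => //.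
exact: inj_can_sym gK g_inj.
Qed.

Lemma uniq_seq_extend_bijection (b : seq nat) : uniq b ->
  exists2 g : nat -> nat, bijective g &
    forall x, x < size b -> g x = nth 0 b x.
Proof.
move=> ub.
(* Stage [s] appends [s] if it is missing, so the chain starting from [b] exhausts the natural
   numbers. *)
pose step s c : seq nat := if s \in c then c else rcons c s.
pose a := fix a s := if s is t.+1 then step t (a t) else b.
have ua s : uniq (a s).
  elim: s => //= s IHs; rewrite /step; case: ifPn => // nin.
  by rewrite rcons_uniq nin.
have pa s : prefix (a s) (a s.+1).
  by rewrite /= /step; case: ifP => _; rewrite ?prefix_refl // prefix_rcons.
have sa s : s \in a s.+1.
  by rewrite /= /step; case: ifP => //; rewrite mem_rcons mem_head.
by have [g bg gE] := chain_limit ua pa sa; exists g => // x; exact: (gE 0).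
Qed.

(** * Isomorphism, and satisfaction as a locally constant function of the structure *)

Section Structures.

Variable tau : vocabulary.

Lemma isomorphic_refl (B : Mod tau) : isomorphic B B.
Proof.
exists id; first by exists id.
by move=> R t; congr (B R _); apply: val_inj; rewrite /= map_id.
Qed.

Lemma isomorphic_sym (B C : Mod tau) : isomorphic B C -> isomorphic C B.
Proof.
move=> [f [g fK gK] BC]; exists g; first by exists f.
move=> R t; rewrite BC; congr (C R _); apply: val_inj.
by rewrite /= -map_comp -[LHS]map_id; apply: eq_map => x /=; rewrite gK.
Qed.

Lemma isomorphic_trans (B C D : Mod tau) :
  isomorphic B C -> isomorphic C D -> isomorphic B D.
Proof.
move=> [f bf BC] [g bg CD]; exists (g \o f); first exact: bij_comp.
move=> R t; rewrite BC CD; congr (D R _); apply: val_inj.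
by rewrite /= map_comp.
Qed.

(** For bijective [g], this is the copy of [B] presented by the enumeration [g]. *)
Definition pullback (g : nat -> nat) (B : Mod tau) : Mod tau :=
  fun R t => B R (map_tuple g t).

Lemma isomorphic_pullback g B : bijective g -> isomorphic (pullback g B) B.
Proof. by exists g. Qed.

Lemma eq_atomic_sat (V : eqType) (B : Mod tau) (v w : V -> nat) p :
  {in atomic_vars p, v =1 w} -> atomic_sat B v p = atomic_sat B w p.
Proof.
case: p => [x y|R t] /= vw; first by rewrite !vw // !inE eqxx ?orbT.
by congr (B R _); apply: val_inj; apply/eq_in_map.
Qed.

Lemma atomic_sat_pullback V g B (v : V -> nat) (p : atomic tau V) :
  injective g -> atomic_sat (pullback g B) v p = atomic_sat B (g \o v) p.
Proof.
move=> gi; case: p => [x y|R t] /=; first by rewrite (inj_eq gi).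
by congr (B R _); apply: val_inj; rewrite /= map_comp.
Qed.

Lemma isomorphic_atomic_sat V f (B C : Mod tau) (v : V -> nat) p :
  injective f -> (forall R t, B R t = C R (map_tuple f t)) ->
  atomic_sat B v p = atomic_sat C (f \o v) p.
Proof.
move=> fi BC; rewrite -atomic_sat_pullback //; congr atomic_sat.
by apply: functional_extensionality_dep => R; apply/funext => t; exact: BC.
Qed.

Lemma near_atomic_sat V (B : Mod tau) (v : V -> nat) p :
  \forall C \near B, atomic_sat C v p = atomic_sat B v p.
Proof.
case: p => [x y|R t]; first by apply: (@nearW _ (nbhs B)).
have /cvg_prod_topology/(_ R) := @cvg_id _ (nbhs B).
move=> /cvg_prod_topology/(_ (map_tuple v t)) /discrete_cvg; exact.
Qed.

Lemma near_qf_sat n (B : Mod tau) (a : n.-tuple nat) (q : qf tau n) :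
  \forall C \near B, qf_sat C a q = qf_sat B a q.
Proof.
elim: q => [|p|q IH|q1 IH1 q2 IH2|q1 IH1 q2 IH2].
- by apply: (@nearW _ (nbhs B)).
- exact: near_atomic_sat.
- by apply: filterS IH => C /= ->.
- by apply: filterS2 IH1 IH2 => C /= -> ->.
- by apply: filterS2 IH1 IH2 => C /= -> ->.
Qed.

Lemma isomorphic_qf_sat n f (B C : Mod tau) (a : n.-tuple nat) q :
  injective f -> (forall R t, B R t = C R (map_tuple f t)) ->
  qf_sat B a q = qf_sat C (map_tuple f a) q.
Proof.
move=> fi BC; elim: q => //= [p|q ->|q1 -> q2 ->|q1 -> q2 ->] //.
rewrite (isomorphic_atomic_sat _ _ fi BC); congr atomic_sat.
by apply/funext => x; rewrite /= tnth_map.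
Qed.

Lemma isomorphic_sigma2_sat (B C : Mod tau) (psi : sigma2 tau) :
  isomorphic B C -> sigma2_sat B psi -> sigma2_sat C psi.
Proof.
move=> [f [g fK gK] BC] [k [a Ba]]; exists k, (map_tuple f a) => l b.
have := Ba l (map_tuple g b); rewrite (isomorphic_qf_sat _ _ (can_inj fK) BC).
congr (is_true (qf_sat _ _ _)); apply: val_inj; rewrite /= map_cat -map_comp.
by congr cat; rewrite -[RHS]map_id; apply: eq_map => x /=; rewrite gK.
Qed.

(** * Finite stages of the verification of a Pi_1 formula *)

(** Only instances (conjunct, tuple) with code below [N] are tested, which makes the test decidable,
    locally constant in [B] and antitone in [N]. Numbers that code nothing pass. *)
Definition pi1_upto n (N : nat) (B : Mod tau) (a : n.-tuple nat)
    (p : pi1 tau n) : bool :=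
  all (fun e =>
    if unpickle e is Some x then
      let x : {k : pi1_index p & (pi1_arity k).-tuple nat} := x in
      qf_sat B (cat_tuple a (tagged x)) (pi1_matrix (tag x))
    else true) (iota 0 N).

Lemma pi1_upto_le n N N' B (a : n.-tuple nat) p :
  N <= N' -> pi1_upto N' B a p -> pi1_upto N B a p.
Proof.
move=> le /allP sat; apply/allP => e; rewrite mem_iota => /= ltN.
by apply: sat; rewrite mem_iota (leq_trans ltN).
Qed.

Lemma pi1_uptoP n B (a : n.-tuple nat) p :
  pi1_sat B a p <-> forall N, pi1_upto N B a p.
Proof.
split=> [Bp N|Bp k b].
  by apply/allP => e _; case: unpickle => // -[k b]; exact: Bp.
pose x : {k : pi1_index p & (pi1_arity k).-tuple nat} := Tagged _ b.
have /allP/(_ (pickle x)) := Bp (pickle x).+1.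
by rewrite mem_iota add0n /= ltnSn pickleK; apply.
Qed.

Lemma near_pi1_upto n N B (a : n.-tuple nat) p :
  \forall C \near B, pi1_upto N C a p = pi1_upto N B a p.
Proof.
pose inst C e := if unpickle e is Some x then
  let x : {k : pi1_index p & (pi1_arity k).-tuple nat} := x in
  qf_sat C (cat_tuple a (tagged x)) (pi1_matrix (tag x)) else true.
have : \forall C \near B, forall e, e < N -> inst C e = inst B e.
  apply: (@near_all_ltn _ (nbhs B)) => e; rewrite /inst.
  case: unpickle => [x|]; first exact: near_qf_sat.
  by apply: (@nearW _ (nbhs B)).
apply: filterS => C CB; apply: eq_in_all => e.
by rewrite mem_iota add0n; exact: CB.
Qed.

(** * Learning by the least unrefuted guess *)

Section LeastGuess.

Variable psi : nat -> sigma2 tau.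

(* A guess [(j, k, a)] asserts that [a] witnesses the [k]-th disjunct of
   [psi j]. *)
Let guess :=
  {j : nat & {k : sigma2_index (psi j) & (sigma2_arity k).-tuple nat}}.

Definition plausible (B : Mod tau) (N e : nat) : bool :=
  if unpickle e is Some c then
    let c : guess := c in
    pi1_upto N B (tagged (tagged c)) (sigma2_matrix (tag (tagged c)))
  else false.

Definition guess_index (e : nat) : nat :=
  if unpickle e is Some c then let c : guess := c in tag c else 0.

(* When no code below [N] is plausible, [find] returns [N] and the value is
   irrelevant. *)
Definition least_guess (B : Mod tau) : baire :=
  fun N => guess_index (find (plausible B N) (iota 0 N)).

Lemma least_guess_continuous : continuous least_guess.
Proof.
move=> B; have FB : Filter (least_guess @ nbhs B) by exact _.
apply/cvg_prod_topology => N; apply/discrete_cvg.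
have : \forall C \near B, forall e, e < N -> plausible C N e = plausible B N e.
  apply: (@near_all_ltn _ (nbhs B)) => e; rewrite /plausible.
  case: unpickle => [c|]; first exact: near_pi1_upto.
  by apply: (@nearW _ (nbhs B)).
apply: filterS => C CB; rewrite /least_guess /=; congr guess_index.
by apply: eq_in_find => e; rewrite mem_iota add0n; exact: CB.
Qed.

(** Let [e] be the least code that is never refuted. The finitely many smaller codes are all refuted
    by a common stage, as refutations are permanent, and from then on the search stops at [e]. *)
Lemma least_guess_lim B : (exists j, sigma2_sat B (psi j)) ->
  exists2 l, least_guess B @ \oo --> l & sigma2_sat B (psi l).
Proof.
move=> [j [k [a Ba]]].
have exe : exists e, `[< forall N, plausible B N e >].
  pose c : guess := Tagged _ (Tagged _ a).
  exists (pickle c); apply/asboolP => N; rewrite /plausible pickleK.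
  by move: N; apply/pi1_uptoP.
case: (ex_minnP exe) => e /asboolP pe mine.
have pmono e' M M' : M <= M' -> plausible B M' e' -> plausible B M e'.
  rewrite /plausible; case: unpickle => // c; exact: pi1_upto_le.
have [N refuted] : exists N, forall e', e' < e -> ~~ plausible B N e'.
  apply: exists_bound => [e' N N' le|e' lte].
    by apply: contra; exact: pmono.
  apply: contrapT => np; move: lte; rewrite ltnNge mine //.
  apply/asboolP => N; apply: contrapT => nN; apply: np.
  by exists N; exact/negP.
exists (guess_index e).
  (* The bound [e.+1] makes [e] lie in the range searched. *)
  apply/discrete_cvg; exists (maxn N e.+1) => // M /=.
  rewrite geq_max => /andP[leN lte]; congr guess_index.
  by apply: find_iota => // e' /refuted; apply: contra; exact: pmono.
rewrite /guess_index; move: pe; rewrite /plausible.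
case: unpickle => [[j' [k' a']] /= /pi1_uptoP|/(_ 0)//].
by exists k', a'.
Qed.

End LeastGuess.

(** * Diagrams and the Pi_1 formula expressing [bf_le1] *)

Section BackAndForth.

Variable phi : nat -> atomic tau nat.

Lemma isomorphic_bf_le1 (B C : Mod tau) n (a : n.-tuple nat) :
  isomorphic B C -> exists b : n.-tuple nat, bf_le1 phi B a C b.
Proof.
move=> [f [g fK gK] BC]; exists (map_tuple f a) => m d; exists (map_tuple g d).
move=> k _ /allP vars; rewrite (isomorphic_atomic_sat _ _ (can_inj fK) BC).
rewrite (@eq_atomic_sat _ _ _ (f \o nth 0 (cat_tuple a (map_tuple g d)))) //.
move=> x /vars ltx /=; rewrite -(nth_map 0 0 f) ?size_cat ?size_map ?size_tuple //.
congr nth; rewrite map_cat -map_comp; congr cat.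
by rewrite -[LHS]map_id; apply: eq_map => y /=; rewrite gK.
Qed.

Definition atomic_map V W (f : V -> W) (p : atomic tau V) : atomic tau W :=
  match p with
  | AEq x y => AEq tau (f x) (f y)
  | ARel R t => ARel (map_tuple f t)
  end.

Lemma atomic_sat_map V W (f : V -> W) (p : atomic tau V) B v :
  atomic_sat B v (atomic_map f p) = atomic_sat B (v \o f) p.
Proof.
by case: p => //= R t; congr (B R _); apply: val_inj; rewrite /= map_comp.
Qed.

(** The trivially true case mirrors the guard in [bf_le0]. The default [k] of [insubd] only
    witnesses that ['I_N] is inhabited; the guard keeps it from being used. *)
Definition diagram_literal N (k : 'I_N) (b : bool) : qf tau N :=
  if all (fun x => x < N) (atomic_vars (phi k)) then
    let q := QAtom (atomic_map (insubd k) (phi k)) in if b then q else QNot q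
  else QNot (QFalse tau N).

Definition diagram N (e : nat -> bool) : qf tau N :=
  foldr (fun k q => QAnd (diagram_literal k (e k)) q) (QNot (QFalse tau N))
    (enum 'I_N).

Lemma diagramP N e B (a : N.-tuple nat) :
  reflect (forall k, k < N -> all (fun x => x < N) (atomic_vars (phi k)) ->
             atomic_sat B (nth 0 a) (phi k) = e k)
          (qf_sat B a (diagram N e)).
Proof.
have litE (k : 'I_N) : qf_sat B a (diagram_literal k (e k)) =
    (all (fun x => x < N) (atomic_vars (phi k)) ==>
     (atomic_sat B (nth 0 a) (phi k) == e k)).
  rewrite /diagram_literal; case: ifP => //= /allP vars.
  have <- : atomic_sat B (tnth a) (atomic_map (insubd k) (phi k)) =
            atomic_sat B (nth 0 a) (phi k).
    rewrite atomic_sat_map; apply: eq_atomic_sat => x /vars ltx.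
    by rewrite /= (tnth_nth 0) val_insubd ltx.
  by case: (e k) => /=; rewrite ?eqb_id ?eqbF_neg.
have -> : qf_sat B a (diagram N e) =
    all (fun k => qf_sat B a (diagram_literal k (e k))) (enum 'I_N).
  by rewrite /diagram; elim: (enum _) => //= k s ->.
apply: (iffP allP) => [sat k ltk vars|sat k _].
  by have := sat (Ordinal ltk) (mem_enum _ _); rewrite litE /= vars => /eqP.
by rewrite litE; apply/implyP => /sat ->.
Qed.

(** A conjunct is indexed by a length and a finite truth table, which keeps the index set countable.
    It forbids the table if no extension of [a] in [B] realizes it, and is trivially true
    otherwise. *)
Definition pi1_theory (B : Mod tau) n (a : n.-tuple nat) : pi1 tau n :=
  @Pi1 tau n (nat * seq bool)%type fst (fun k =>
    if `[< exists c : k.1.-tuple nat,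
           qf_sat B (cat_tuple a c) (diagram _ (nth false k.2)) >]
    then QNot (QFalse _ _) else QNot (diagram _ (nth false k.2))).

Lemma pi1_theoryP B n (a : n.-tuple nat) C b :
  pi1_sat C b (pi1_theory B a) <-> bf_le1 phi B a C b.
Proof.
split=> [Cb m d|le1 [m e] d /=].
  (* The truth table realized by [d] itself: its conjunct would exclude [d] unless some [c] realizes
     the same table over [a]. *)
  pose e := mkseq (fun k => atomic_sat C (nth 0 (cat_tuple b d)) (phi k)) (n + m).
  have := Cb (m, e) d; rewrite /=; case: asboolP => [[c /diagramP Bc] _|_].
    by exists c => k ltk vars; rewrite Bc // nth_mkseq.
  by move=> /negP[]; apply/diagramP => k ltk _; rewrite nth_mkseq.
case: asboolP => //= nBc; apply/negP => /diagramP Cd; apply: nBc.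
have [c le0] := le1 m d; exists c; apply/diagramP => k ltk vars.
by rewrite -Cd //; apply/idP/idP => /(le0 k ltk vars).
Qed.

(** * Finite atomic information and basic neighbourhoods *)

Hypothesis phi_enum : forall p : atomic tau nat, exists k, phi k = p.

(** Under the valuation [id] the variable [x] denotes the element [x], so the [phi k] enumerate the
    atomic diagram. *)
Definition agree_upto N (B C : Mod tau) : Prop :=
  forall k, k < N -> atomic_sat B id (phi k) = atomic_sat C id (phi k).

(** The sets of structures agreeing with [B] up to [N] generate a filter. It converges to [B]
    because each coordinate of a structure is decided by some [phi k]. *)
Lemma nbhs_agree_upto (B : Mod tau) (U : set (Mod tau)) :
  nbhs B U -> exists N, agree_upto N B `<=` U.
Proof.
pose F : set_system (Mod tau) := filter_from setT (agree_upto^~ B).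
have FF : Filter F.
  apply: filter_from_filter; first by exists 0.
  move=> N M _ _; exists (maxn N M) => // C CB.
  by split=> k ltk; apply: CB; rewrite leq_max ltk ?orbT.
have FB : F --> B.
  apply/cvg_prod_topology => R; apply/cvg_prod_topology => t.
  apply/discrete_cvg; have [k phik] := phi_enum (ARel t).
  exists k.+1 => // C /(_ k (ltnSn k)); rewrite phik /=.
  by have -> : map_tuple id t = t by apply: val_inj; rewrite /= map_id.
move=> /FB[N _ sub]; exists N => C BC; apply: sub => k ltk.
by rewrite BC.
Qed.

Lemma bf_le1_uniq (B C : Mod tau) n (a b : n.-tuple nat) :
  bf_le1 phi B a C b -> uniq a -> uniq b.
Proof.
move=> le1 ua; apply/(uniqP 0) => x y; rewrite !inE !size_tuple => ltx lty bxy.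
have [k phik] := phi_enum (AEq tau x y).
(* The zeros are padding: they only make the tuples longer than [k], so that [bf_le0] tests the
   equation [phi k]. *)
have [c /(_ k)] := le1 k.+1 (nseq_tuple k.+1 0).
rewrite phik /= !(ltn_addr _ ltx) !(ltn_addr _ lty) addnS ltnS leq_addl.
rewrite !nth_cat !size_tuple ltx lty bxy eqxx => -[//|//|+ _] => /(_ isT)/eqP.
by move/(uniqP 0 ua); rewrite !inE !size_tuple => ->.
Qed.

(* Finitely many atomic facts about an enumeration [h] of [C] extending [b]
   are facts about some tuple [b ++ d], hence hold of some [a ++ c] in [B]. *)
Lemma bf_le1_extend (B C : Mod tau) n (a b : n.-tuple nat) h N :
  bf_le1 phi B a C b -> uniq a -> bijective h ->
  (forall x, x < n -> h x = nth 0 b x) ->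
  exists a' : seq nat, [/\ uniq a', prefix a a' &
    forall g, bijective g -> (forall x, x < size a' -> g x = nth 0 a' x) ->
      agree_upto N (pullback h C) (pullback g B)].
Proof.
move=> le1 ua bh hb.
(* [n + m] bounds the variables of the first [N] formulas, and [M] bounds indices of all equations
   between variables below [n + m]. The latter serve to transfer distinctness from [h] to the new
   tuple. *)
have [m vars_m] : exists m, forall k, k < N ->
    all (fun x => x < n + m) (atomic_vars (phi k)).
  apply: exists_bound => [k m m' le|k _].
    apply: sub_all => x /leq_trans; apply; by rewrite leq_add2l.
  exists (\max_(x <- atomic_vars (phi k)) x).+1; apply/allP => x xin.
  by rewrite addnS ltnS (leq_trans _ (leq_addl _ _)) // leq_bigmax_seq.
have [M eq_M] : exists M, forall x, x < n + m -> forall y, y < n + m ->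
    exists2 k, k < M & phi k = AEq tau x y.
  apply: exists_bound => [x M M' le ex y /ex[k ltk <-]|x _].
    by exists k => //; exact: leq_trans le.
  apply: exists_bound => [y M M' le [k ltk <-]|y _].
    by exists k => //; exact: leq_trans le.
  by have [k <-] := phi_enum (AEq tau x y); exists k.+1, k.
(* Length [m] covers the variables and [N + M] the formula indices; [b] followed by
   [h n, ..., h (n + p - 1)] is an initial segment of [h]. *)
pose p := m + (N + M).
have [c le0] := le1 p (map_tuple h (iota_tuple p n)).
have bE x : x < n + p ->
    nth 0 (cat_tuple b (map_tuple h (iota_tuple p n))) x = h x.
  move=> ltx; rewrite /= nth_cat size_tuple; case: ltnP => [/hb//|lenx].
  by rewrite (nth_map 0) ?size_iota ?nth_iota ?subnKC // ltn_subLR.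
have satE k : k < N + M -> all (fun x => x < n + m) (atomic_vars (phi k)) ->
    atomic_sat C h (phi k) = atomic_sat B (nth 0 (a ++ c)) (phi k).
  move=> ltk /allP vars.
  have vars' x : x \in atomic_vars (phi k) -> x < n + p.
    by move=> /vars/leq_trans; apply; rewrite leq_add2l leq_addr.
  have ltk' : k < n + p by apply: leq_trans ltk _; rewrite addnA leq_addl.
  rewrite -(@eq_atomic_sat _ _ _ _ _ (fun x xin => bE x (vars' x xin))).
  have vars'' : all (fun x => x < n + p) (atomic_vars (phi k)) by apply/allP.
  by apply/idP/idP => /(le0 k ltk' vars'').
have size_ac : size (a ++ c) = n + p by rewrite size_cat !size_tuple.
have le_mp : n + m <= n + p by rewrite leq_add2l leq_addr.
have size_a' : size (take (n + m) (a ++ c)) = n + m.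
  by rewrite size_takel // size_ac.
(* Only the first [n + m] entries are kept, since distinctness is controlled only there. *)
exists (take (n + m) (a ++ c)); split.
- apply/(uniqP 0) => x y; rewrite !inE size_a' => ltx lty.
  rewrite !nth_take // => /eqP acxy; have [k ltk phik] := eq_M x ltx y lty.
  have /= := satE k; rewrite phik /= ltx lty acxy => /(_ _ isT)/eqP.
  move=> hxy; apply: (bij_inj bh); apply: hxy.
  exact: leq_trans ltk (leq_addl _ _).
- apply/prefixP; exists (take m c).
  by rewrite take_cat size_tuple ltnNge leq_addr /= addKn.
move=> g bg gE k ltk; rewrite !atomic_sat_pullback; try exact: bij_inj.
have /allP vars := vars_m k ltk.
rewrite (satE k (ltn_addr _ ltk) (vars_m k ltk)).
apply: eq_atomic_sat => x /vars ltx /=.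
by rewrite gE ?size_a' // nth_take.
Qed.

(** * Fooling a learner, and the cycle of implications *)

Variables (K : set (Mod tau)) (A : nat -> Mod tau).
Hypotheses (K_inv : iso_invariant K) (A_in_K : forall i, K (A i)).

Lemma pullback_in_K g i : bijective g -> K (pullback g (A i)).
Proof.
move=> bg; apply: K_inv (A_in_K i); apply: isomorphic_sym.
exact: isomorphic_pullback.
Qed.

(** The [n]-th answer is a continuous map from [K] to a discrete space, hence locally constant on
    [K]. *)
Lemma learner_agree_upto (L : Mod tau -> baire) B n :
  learner K L -> K B ->
  exists N, forall C, K C -> agree_upto N B C -> L C n = L B n.
Proof.
move=> /subspace_continuousP/(_ B) cL KB.
have /cvg_prod_topology/(_ n)/discrete_cvg := cL KB.
move=> /nbhs_agree_upto[N sub].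
by exists N => C KC BC; apply: (sub C BC).
Qed.

(** One stage of the construction: an answer that is right for a copy of [A j] is wrong for [A i],
    and it is forced on every enumeration of [A i] extending [a']. *)
Lemma BC_learner_fooled (L : Mod tau -> baire) i s (a : seq nat) :
  learner K L ->
  (forall (j : nat) (S : Mod tau), K S -> isomorphic S (A j) ->
      \forall n \near \oo, isomorphic (A (L S n)) (A j)) ->
  (forall n (a : n.-tuple nat), exists j (b : n.-tuple nat),
      bf_le1 phi (A i) a (A j) b /\ ~ isomorphic (A i) (A j)) ->
  uniq a ->
  exists a' : seq nat, [/\ uniq a', prefix a a', s \in a' &
    forall g, bijective g -> (forall x, x < size a' -> g x = nth 0 a' x) ->
      exists2 n, s <= n & ~ isomorphic (A (L (pullback g (A i)) n)) (A i)].
Proof.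
move=> cL BC nsep ua.
have [j [b [le1 nij]]] := nsep _ (in_tuple a).
have [h bh hE] := uniq_seq_extend_bijection (bf_le1_uniq le1 ua).
have Kh := pullback_in_K j bh.
have [n0 _ conv] := BC j _ Kh (isomorphic_pullback _ bh).
(* Beyond [n0] the answer is right for [A j]; beyond [s] the mistakes of successive stages occur
   arbitrarily late. *)
pose n := maxn n0 s.
have [N LN] := learner_agree_upto n cL Kh.
have hE' x : x < size a -> h x = nth 0 b x by move=> ltx; rewrite hE ?size_tuple.
have [a' [ua' paa' a'E]] := bf_le1_extend N le1 ua bh hE'.
have fooled g : bijective g -> (forall x, x < size a' -> g x = nth 0 a' x) ->
    exists2 n, s <= n & ~ isomorphic (A (L (pullback g (A i)) n)) (A i).
  move=> bg gE; exists n; first exact: leq_maxr.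
  rewrite (LN _ (pullback_in_K i bg) (a'E g bg gE)) => Ai; apply: nij.
  apply: isomorphic_trans (isomorphic_sym Ai) _.
  by apply: conv; exact: leq_maxl.
have [sa'|sa'] := boolP (s \in a'); first by exists a'.
exists (rcons a' s); split; rewrite ?rcons_uniq ?sa' ?mem_rcons ?mem_head //.
  exact: prefix_trans paa' (prefix_rcons _ _).
move=> g bg gE; apply: fooled => // x ltx.
by rewrite gE ?size_rcons ?nth_rcons ?ltx // ltnW.
Qed.

Lemma Ex_learnable_BC : Ex_learnable K A -> BC_learnable K A.
Proof.
move=> [L cL ExL]; exists L => // i S KS /(ExL i S KS)[l Ll iso].
by have [N _ LN] := Ll _ (discrete_set1 l); exists N => // n /LN /= ->.
Qed.

Lemma BC_learnable_separated : BC_learnable K A -> bf_separated phi A.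
Proof.
move=> [L cL BC] i; apply: contrapT => nsep.
have {}nsep n (a : n.-tuple nat) : exists j (b : n.-tuple nat),
    bf_le1 phi (A i) a (A j) b /\ ~ isomorphic (A i) (A j).
  apply: contrapT => none; apply: nsep; exists n, a => j b.
  have [le1|] := pselect (bf_le1 phi (A i) a (A j) b); last by left.
  by right; apply: contrapT => nij; apply: none; exists j, b.
(* Uniqueness is a premise inside the specification so that [step] is total; the value [[::]] on
   sequences with repetitions is junk. *)
have /choice[step stepP] (sa : nat * seq nat) : exists a' : seq nat, uniq sa.2 ->
    [/\ uniq a', prefix sa.2 a', sa.1 \in a' &
    forall g, bijective g -> (forall x, x < size a' -> g x = nth 0 a' x) ->
      exists2 n, sa.1 <= n &
        ~ isomorphic (A (L (pullback g (A i)) n)) (A i)].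
  have [ua|nua] := boolP (uniq sa.2); last by exists [::].
  by have [a' a'P] := BC_learner_fooled sa.1 cL BC nsep ua; exists a'.
(* The stage number [t] is both the element to be enumerated and the lower bound for the position of
   the mistake. *)
pose a := fix a s := if s is t.+1 then step (t, a t) else [::].
have ua s : uniq (a s) by elim: s => //= s /(stepP (s, a s))[].
have pa s : prefix (a s) (a s.+1) by have [] := stepP (s, a s) (ua s).
have sa s : s \in a s.+1 by have [] := stepP (s, a s) (ua s).
have [g bg gE] := chain_limit ua pa sa.
have [N _ conv] := BC i _ (pullback_in_K i bg) (isomorphic_pullback _ bg).
(* The mistake planted at stage [N] occurs at some [n >= N], where the learner should already be
   right. *)
have [_ _ _ /(_ g bg (gE N.+1))[n leN]] := stepP (N, a N) (ua N).
by apply; exact: conv.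
Qed.

Lemma separated_sigma2_quasi_Scott :
  bf_separated phi A -> has_sigma2_quasi_Scott_sentences A.
Proof.
move=> sep.
have /choice[a aP] i : exists a : {n : nat & n.-tuple nat}, forall j b,
    ~ bf_le1 phi (A i) (tagged a) (A j) b \/ isomorphic (A i) (A j).
  by have [n [a aP]] := sep i; exists (Tagged _ a).
exists (fun i => @Sigma2 tau unit (fun=> tag (a i))
                   (fun=> pi1_theory (A i) (tagged (a i)))) => j i.
split=> [[[] [b /pi1_theoryP le1]]|/isomorphic_sym ij].
  by case: (aP i j b) => // /isomorphic_sym.
have [b le1] := isomorphic_bf_le1 (tagged (a i)) ij.
by exists tt, b; apply/pi1_theoryP.
Qed.

(** The limit [l] may differ from [i], but [psi l] holds in [S], hence in [A i], and this forces
    [A i] and [A l] to be isomorphic. *)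
Lemma sigma2_quasi_Scott_Ex_learnable :
  has_sigma2_quasi_Scott_sentences A -> Ex_learnable K A.
Proof.
move=> [psi psiP]; exists (least_guess psi).
  by apply: continuous_subspaceT; exact: least_guess_continuous.
move=> i S KS iso.
have [|l Sl Spsi] := @least_guess_lim psi S.
  exists i; apply: isomorphic_sigma2_sat (isomorphic_sym iso) _.
  exact/psiP/isomorphic_refl.
exists l => //; apply/isomorphic_sym/psiP.
exact: isomorphic_sigma2_sat iso Spsi.
Qed.

Lemma bf_strongly_separatedE :
  (forall i j, i <> j -> ~ isomorphic (A i) (A j)) ->
  bf_strongly_separated phi A <-> bf_separated phi A.
Proof.
move=> niso; split=> sep i; have [n [a aP]] := sep i; exists n, a => j b.
  have [->|/eqP ji] := eqVneq j i; first by right; exact: isomorphic_refl.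
  by left; exact: aP.
by move=> ji; case: (aP j b) => // /niso; case; exact: nesym.
Qed.

End BackAndForth.

End Structures.

Theorem theorem3p3 (tau : vocabulary)
    (phi : nat -> atomic tau nat)
    (phi_enum : forall psi : atomic tau nat, exists k : nat, phi k = psi)
    (K : set (Mod tau)) (K_inv : iso_invariant K)
    (A : nat -> Mod tau) (A_in_K : forall i : nat, K (A i)) :
  [<-> Ex_learnable K A;
       BC_learnable K A;
       bf_separated phi A;
       has_sigma2_quasi_Scott_sentences A]
  /\ ((forall i j : nat, i <> j -> ~ isomorphic (A i) (A j)) ->
      [<-> Ex_learnable K A;
           BC_learnable K A;
           bf_strongly_separated phi A;
           has_sigma2_quasi_Scott_sentences A]).
Proof.
have BC_sep := BC_learnable_separated phi_enum K_inv A_in_K.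
split=> [|/(bf_strongly_separatedE phi) strongE]; tfae.
- exact: Ex_learnable_BC.
- exact: BC_sep.
- exact: (@separated_sigma2_quasi_Scott _ phi).
- exact: sigma2_quasi_Scott_Ex_learnable.
- exact: Ex_learnable_BC.
- by move=> /BC_sep/strongE.
- by move=> /strongE; exact: (@separated_sigma2_quasi_Scott _ phi).
- exact: sigma2_quasi_Scott_Ex_learnable.
Qed.
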